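(* Let $r=\{r_j\}_{j=1}^\infty$ be a sequence of integers with $r_j\ge 2$ for each $j$, and let $Y$, $Y_0$, $d$, $\rho$, $D$ and $A:\mathbf{R}\times Y_0\to Y$ be as defined in the context. Then $$d(A(a,x),A(b,y))\le 2\pi\, D((a,x),(b,y))\qquad\text{for all }(a,x),(b,y)\in\mathbf{R}\times Y_0 .$$ Moreover, if the sequence $\{r_j\}_{j=1}^\infty$ is bounded, then there is a constant $c_2>0$ such that $$D((a,x),(b,y))\le c_2\, d(A(a,x),A(b,y))$$ for all $(a,x),(b,y)\in\mathbf{R}\times Y_0$ with $|a-b|\le 1/2$.
   Context: Let $r=\{r_j\}_{j=1}^\infty$ be a sequence of integers $\ge 2$; put $R_0=1$ and $R_l=\prod_{j=1}^l r_j$ for $l\ge 1$. Let $X=\prod_{l=0}^\infty(\mathbf{R}/R_l\mathbf{Z})$, a commutative group under coordinatewise addition. A sequence $x=\{x_l\}_{l=0}^\infty\in X$ is coherent if, for each $l\ge 0$, $x_l$ is the image of $x_{l+1}$ under the natural homomorphism $\mathbf{R}/R_{l+1}\mathbf{Z}\to\mathbf{R}/R_l\mathbf{Z}$. Let $Y\subseteq X$ be the subgroup of coherent sequences. Let $\phi_l:\mathbf{R}/R_l\mathbf{Z}\to\{z\in\mathbf{C}:|z|=1\}$ be the isomorphism induced by $a\mapsto\exp(2\pi i R_l^{-1}a)$, and put $d_l(x_l,y_l)=|\phi_l(x_l)-\phi_l(y_l)|$. Put $t_0=1$ and $t_l=1/R_{l-1}$ for $l\ge 1$. The metric $d$ on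 $X$ (and, by restriction, on $Y$) is $d(x,y)=\max_{l\ge 0}t_l\,d_l(x_l,y_l)$. Let $Y_0$ be the set of coherent sequences in $X_0=\prod_{l=1}^\infty(\mathbf{Z}/R_l\mathbf{Z})$, that is, sequences $\{x_l\}_{l=1}^\infty$ such that $x_l$ is the image of $x_{l+1}$ under $\mathbf{Z}/R_{l+1}\mathbf{Z}\to\mathbf{Z}/R_l\mathbf{Z}$ for each $l\ge 1$. Identify $Y_0$ with the subgroup $\{y\in Y: y_0=0\}$ of $Y$ by setting $x_0=0$ in $\mathbf{R}/\mathbf{Z}$. For distinct $x,y\in X_0$, let $l(x,y)$ be the smallest positive integer $l$ with $x_l\ne y_l$, and put $\rho(x,y)=1/R_{l(x,y)-1}$; put $\rho(x,x)=0$. This is an ultrametric. Let $q:\mathbf{R}\to Y$ be the homomorphism $q(a)=\{q_l(a)\}_{l=0}^\infty$, where $q_l:\mathbf{R}\to\mathbf{R}/R_l\mathbf{Z}$ is the quotient map. Define $A:\mathbf{R}\times Y_0\to Y$ by $A(a,x)=q(a)+x$, the sum being taken in $Y$. The metric $D$ on $\mathbf{R}\times Y_0$ is $D((a,x),(b,y))=\max(|a-b|,\rho(x,y))$. *)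

(* Defs.v *)
From HB Require Import structures.
From mathcomp Require Import all_boot all_order all_algebra.
From mathcomp Require Import generic_quotient ring_quotient.
From mathcomp Require Import all_classical all_reals all_analysis.
From mathcomp.real_closed Require Import complex.

Set Implicit Arguments.
Unset Strict Implicit.
Unset Printing Implicit Defensive.
Import Order.TTheory GRing.Theory Num.Theory.
Local Open Scope ring_scope.
Local Open Scope quotient_scope.
Local Open Scope classical_set_scope.

(* The sequence r is indexed from 1; the value r 0 is never used. *)
Definition Rprod (r : nat -> nat) (l : nat) : nat :=
  (\prod_(1 <= j < l.+1) r j)%N.

Lemma Rprod0 r : Rprod r 0 = 1%N.
Proof. by rewrite /Rprod big_geq. Qed.

Lemma RprodS r l : Rprod r l.+1 = (Rprod r l * r l.+1)%N.
Proof. by rewrite /Rprod big_nat_recr. Qed.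

Section QuotientByMultiples.
Variable V : nzRingType.

(* The subgroup n Z of V; used with V = R and V = int. *)
Definition multiples (n : nat) : {pred V} :=
  fun x => `[< exists k : int, x = k%:~R * n%:R >].

Lemma multiples_zmod_closed n : zmod_closed (multiples n).
Proof.
split=> [|x y /asboolP[i ->] /asboolP[j ->]]; apply/asboolP.
  by exists 0; rewrite mul0r.
by exists (i - j); rewrite rmorphB mulrBl.
Qed.

HB.instance Definition _ n :=
  GRing.isZmodClosed.Build V (multiples n) (multiples_zmod_closed n).

Definition modZ (n : nat) : zmodType := Quotient.quot (multiples n).

Definition to_modZ (n : nat) (a : V) : modZ n := \pi_(Quotient.quot (multiples n)) a.

Definition lift_modZ (n : nat) (x : modZ n) : V :=
  repr (x : Quotient.quot (multiples n)).

Lemma lift_modZK n (x : modZ n) : to_modZ n (lift_modZ x) = x.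
Proof. exact: reprK. Qed.

Lemma to_modZ_eqP n a b :
  to_modZ n a = to_modZ n b <-> exists k : int, a - b = k%:~R * n%:R.
Proof.
split=> [/eqP|h].
  by rewrite /to_modZ -Quotient.idealrBE => /asboolP.
by apply/eqP; rewrite /to_modZ -Quotient.idealrBE; apply/asboolP.
Qed.

Lemma to_modZD n a b : to_modZ n (a + b) = to_modZ n a + to_modZ n b.
Proof. by rewrite /to_modZ !piE. Qed.

Lemma to_modZN n a : to_modZ n (- a) = - to_modZ n a.
Proof. by rewrite /to_modZ !piE. Qed.

Lemma to_modZ0 n : to_modZ n 0 = 0.
Proof. by rewrite /to_modZ !piE. Qed.

(* The natural homomorphism V / m Z -> V / n Z, well defined when n | m. *)
Definition reduce (m n : nat) (x : modZ m) : modZ n :=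
  to_modZ n (lift_modZ x).

Lemma reduce_to_modZ m n a :
  (n %| m)%N -> reduce n (to_modZ m a) = to_modZ n a.
Proof.
case/dvdnP=> c mE; apply/to_modZ_eqP.
have /to_modZ_eqP[k ->] := lift_modZK (to_modZ m a).
by exists (k * c%:Z); rewrite mE natrM rmorphM /= -mulrA.
Qed.

Lemma reduce0 m n : (n %| m)%N -> @reduce m n 0 = 0.
Proof. by move=> nm; rewrite -to_modZ0 reduce_to_modZ // to_modZ0. Qed.

Lemma reduceB m n x y :
  (n %| m)%N -> @reduce m n (x - y) = reduce n x - reduce n y.
Proof.
move=> nm; rewrite -{1}[x]lift_modZK -{1}[y]lift_modZK.
by rewrite -to_modZN -to_modZD reduce_to_modZ // to_modZD to_modZN.
Qed.

End QuotientByMultiples.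

Section Solenoid.
Variables (R : realType) (r : nat -> nat).
Local Notation R_ := (Rprod r).

Lemma dvd_Rprod l : (R_ l %| R_ l.+1)%N.
Proof. by rewrite RprodS dvdn_mulr. Qed.

Definition X := forall l : nat, modZ R (R_ l).

HB.instance Definition _ := gen_eqMixin X.
HB.instance Definition _ := gen_choiceMixin X.

Definition addX (x y : X) : X := fun l => x l + y l.
Definition oppX (x : X) : X := fun l => - x l.
Definition zeroX : X := fun l => 0.

Fact addXA : associative addX.
Proof. by move=> x y z; apply: functional_extensionality_dep => l; apply: addrA. Qed.
Fact addXC : commutative addX.
Proof. by move=> x y; apply: functional_extensionality_dep => l; apply: addrC. Qed.
Fact add0X : left_id zeroX addX.
Proof. by move=> x; apply: functional_extensionality_dep => l; apply: add0r. Qed.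
Fact addNX : left_inverse zeroX oppX addX.
Proof. by move=> x; apply: functional_extensionality_dep => l; apply: addNr. Qed.

HB.instance Definition _ := GRing.isZmodule.Build X addXA addXC add0X addNX.

Definition coherent : {pred X} :=
  fun x => `[< forall l, x l = reduce (R_ l) (x l.+1) >].

Fact coherent_zmod_closed : zmod_closed coherent.
Proof.
split=> [|x y /asboolP xP /asboolP yP]; apply/asboolP => l.
  by rewrite reduce0 // dvd_Rprod.
have E k : (x - y) k = x k - y k by [].
by rewrite !E (reduceB _ _ (dvd_Rprod l)) -xP -yP.
Qed.

HB.instance Definition _ :=
  GRing.isZmodClosed.Build X coherent coherent_zmod_closed.

Record Y := MkY { Yval : X; YvalP : Yval \in coherent }.

HB.instance Definition _ := [isSub of Y for Yval].
HB.instance Definition _ := [Choice of Y by <:].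
HB.instance Definition _ := [SubChoice_isSubZmodule of Y by <:].

(* exp (i t), through Euler's formula. *)
Definition expi (t : R) : R[i] := Complex (cos t) (sin t).

Lemma expiD2piz t (k : int) : expi (t + 2 * pi * k%:~R) = expi t.
Proof.
have N u (n : nat) : expi (u + 2 * pi * n%:R) = expi u.
  have -> : 2 * pi * n%:R = (pi *+ 2) *+ n :> R.
    by rewrite mulr_natl mulr_natr.
  by rewrite /expi (periodicn (@cosD2pi R)) (periodicn (@sinD2pi R)).
case: k => n; first exact: N.
rewrite -[in RHS](subrK (2 * pi * n.+1%:R) t) N NegzE.
by congr expi; rewrite mulrNz mulrN.
Qed.

(* By phi_to_modZ below, this does not depend on the representative. *)
Definition phi (l : nat) (x : modZ R (R_ l)) : R[i] :=
  expi (2 * pi * (R_ l)%:R^-1 * lift_modZ x).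

Lemma phi_to_modZ l a : phi (to_modZ (R_ l) a) = expi (2 * pi * (R_ l)%:R^-1 * a).
Proof.
rewrite /phi; set b := lift_modZ _.
have /to_modZ_eqP[k] : to_modZ (R_ l) b = to_modZ (R_ l) a by exact: lift_modZK.
move=> /eqP; rewrite subr_eq => /eqP ->.
have [->|Rl0] := eqVneq (R_ l) 0%N; first by rewrite mulr0 add0r.
rewrite -[RHS](expiD2piz _ k); congr expi.
have nz : (R_ l)%:R != 0 :> R by rewrite pnatr_eq0.
by rewrite mulrDr addrC mulrCA divfK // [k%:~R * _]mulrC.
Qed.

(* Normc.normc is the modulus R[i] -> R. *)
Definition coord_dist (l : nat) (x y : modZ R (R_ l)) : R :=
  Normc.normc (phi x - phi y).

Definition weight (l : nat) : R := if l is l'.+1 then (R_ l')%:R^-1 else 1.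

(* By distX_max below, this supremum is attained. *)
Definition distX (x y : X) : R :=
  sup (range (fun l => weight l * coord_dist (x l) (y l))).

Section DistXMax.
Hypothesis r_ge2 : forall j, (1 <= j)%N -> (2 <= r j)%N.

Let ltn_Rprod l : (l < R_ l)%N.
Proof.
elim: l => [|l IH]; first by rewrite Rprod0.
rewrite RprodS; apply: (@leq_trans (R_ l * 2)).
  rewrite muln2 -addnn; apply: (@leq_trans (R_ l + 1)); first by rewrite addn1.
  by rewrite leq_add2l (leq_trans _ IH).
by rewrite leq_mul2l r_ge2 ?orbT.
Qed.

Let weight_ge0 l : 0 <= weight l.
Proof. by case: l => //= l; rewrite invr_ge0. Qed.

Let normc_expi t : Normc.normc (expi t) = 1.
Proof. by rewrite /= cos2Dsin2 sqrtr1. Qed.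

Let coord_dist_ge0 l x y : 0 <= @coord_dist l x y.
Proof.
by rewrite /coord_dist; case: (phi x - phi y) => u v /=; apply: sqrtr_ge0.
Qed.

Let coord_dist_le2 l x y : @coord_dist l x y <= 2.
Proof.
by rewrite (le_trans (le_normcD _ _)) // normcN !normc_expi.
Qed.

Lemma distX_max (x y : X) :
  (forall l, weight l * coord_dist (x l) (y l) <= distX x y) /\
  exists l, weight l * coord_dist (x l) (y l) = distX x y.
Proof.
pose v l := weight l * coord_dist (x l) (y l).
suff [m vm] : exists m, forall l, v l <= v m.
  have vmE : v m = distX x y.
    apply/eqP; rewrite eq_le; apply/andP; split.
      by apply: ub_le_sup; [exists (v m) => _ [l _ <-]; exact: vm | exists m].
    by apply: ge_sup; [exists (v m), m | move=> _ [l _ <-]; exact: vm].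
  by split; [move=> l; rewrite -vmE; exact: vm | exists m].
have v_ge0 l : 0 <= v l by rewrite mulr_ge0.
have [v0|/existsNP[k /eqP vk]] := pselect (forall l, v l = 0).
  by exists 0%N => l; rewrite !v0.
have vk_gt0 : 0 < v k by rewrite lt0r vk v_ge0.
pose L := (maxn k (Num.truncn (2 / v k)).+1).
have tail l : (L < l)%N -> v l <= v k.
  case: l => // l; rewrite ltnS geq_max => /andP[_ lL].
  have : v l.+1 <= (R_ l)%:R^-1 * 2 by rewrite ler_wpM2l // invr_ge0.
  move=> /le_trans; apply.
  have Rl : 0 < (R_ l)%:R :> R by rewrite ltr0n (leq_trans _ (ltn_Rprod l)).
  rewrite mulrC ler_pdivrMr // mulrC -ler_pdivrMr //.
  apply: (le_trans (ltW (truncnS_gt _))).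
  by rewrite ler_nat (leq_trans lL) // ltnW.
pose m := [arg max_(i > (ord0 : 'I_L.+1)) v i]%O.
have vm (i : 'I_L.+1) : v i <= v m.
  by rewrite /m; case: arg_maxP => //= j _ vj; exact: vj.
exists m => l; have [lL|Ll] := leqP l L.
  exact: (vm (Ordinal (lL : (l < L.+1)%N))).
rewrite (le_trans (tail _ Ll)) //.
by apply: (vm (@Ordinal L.+1 k _)); rewrite ltnS leq_max leqnn.
Qed.

End DistXMax.

Definition distY (x y : Y) : R := distX (val x) (val y).

(* X_0 starts at index 1: for x : X0, the term (x l) is the coordinate of
   index l.+1. *)
Definition X0 := forall l : nat, modZ int (R_ l.+1).

Definition coherent0 (x : X0) : Prop :=
  forall l, x l = reduce (R_ l.+1) (x l.+1).

Definition Y0 := {x : X0 | coherent0 x}.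

Lemma neqX0 (x y : X0) : x <> y -> exists l, x l != y l.
Proof.
move=> xy; apply: contrapT => /forallNP h; apply: xy.
by apply: functional_extensionality_dep => l; apply/eqP/negPn/negP/h.
Qed.

(* The smallest positive index, hence the shift by one, at which x and y
   differ. *)
Definition first_diff (x y : X0) (xy : x <> y) : nat := (ex_minn (neqX0 xy)).+1.

Definition rho (x y : X0) : R :=
  if pselect (x = y) is right xy then (R_ (first_diff xy).-1)%:R^-1 else 0.

(* The inclusion Z / n Z -> R / n Z. *)
Definition incl (n : nat) (x : modZ int n) : modZ R n :=
  to_modZ n (lift_modZ x)%:~R.

Lemma incl_to_modZ n (a : int) : incl (to_modZ n a) = to_modZ n a%:~R.
Proof.
apply/to_modZ_eqP.
have /to_modZ_eqP[k kE] := lift_modZK (to_modZ n a).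
by exists k; rewrite -rmorphB /= kE rmorphM /= intz natz.
Qed.

Definition embX (x : X0) : X := fun l =>
  if l is l'.+1 return modZ R (R_ l) then incl (x l') else 0.

Fact embX_coherent (x : Y0) : embX (sval x) \in coherent.
Proof.
case: x => x xP; apply/asboolP => -[|l] /=.
  rewrite /incl reduce_to_modZ ?dvd_Rprod // -[LHS]to_modZ0; apply/to_modZ_eqP.
  by exists (- lift_modZ (x 0%N)); rewrite Rprod0 mulr1 sub0r rmorphN.
by rewrite (xP l) incl_to_modZ /incl reduce_to_modZ ?dvd_Rprod.
Qed.

Definition emb (x : Y0) : Y := MkY (embX_coherent x).

Lemma incl_inj n : injective (@incl n).
Proof.
move=> x y; rewrite -[x]lift_modZK -[y]lift_modZK !incl_to_modZ.
case/to_modZ_eqP=> k; rewrite -rmorphB /= -[n%:R]/(n%:~R) -rmorphM /=.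
by move/intr_inj=> kE; apply/to_modZ_eqP; exists k; rewrite kE intz natz.
Qed.

Lemma emb_inj : injective emb.
Proof.
move=> [x xc] [y yc] /(congr1 val) xy; apply: eq_exist => /=.
apply: functional_extensionality_dep => l; apply: incl_inj.
exact: (congr1 (fun z : X => z l.+1) xy).
Qed.

(* The identification of Y_0 with the subgroup y_0 = 0 of Y. *)
Lemma range_emb : range emb = [set y | val y 0%N = 0].
Proof.
apply/seteqP; split=> [_ [x _ <-] //|y /= y0].
have /asboolP yc := valP y.
have yE l : exists n : int, val y l = to_modZ (R_ l) n%:~R.
  elim: l => [|l [n yl]]; first by exists 0; rewrite to_modZ0; exact: y0.
  move: (yc l); rewrite yl => /to_modZ_eqP[k] kE; exists (n - k * (R_ l)%:Z).
  rewrite -[LHS]lift_modZK; congr to_modZ.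
  by rewrite rmorphB rmorphM /= -pmulrn -kE opprB addrC subrK.
have [n nE] := choice yE.
pose x : X0 := fun l => to_modZ (R_ l.+1) (n l.+1).
have xc : coherent0 x.
  move=> l; rewrite /x reduce_to_modZ ?dvd_Rprod //; apply: incl_inj.
  rewrite !incl_to_modZ -nE (yc l.+1) nE.
  by rewrite reduce_to_modZ ?dvd_Rprod.
exists (exist _ x xc) => //; apply: val_inj => /=.
apply: functional_extensionality_dep => -[|l]; first exact: esym y0.
by rewrite /= /x incl_to_modZ -nE.
Qed.

Definition qX (a : R) : X := fun l => to_modZ (R_ l) a.

Fact qX_coherent a : qX a \in coherent.
Proof. by apply/asboolP => l; rewrite /qX reduce_to_modZ ?dvd_Rprod. Qed.

Definition q (a : R) : Y := MkY (qX_coherent a).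

Definition A (p : R * Y0) : Y := q p.1 + emb p.2.

Definition D (p p' : R * Y0) : R :=
  Num.max `|p.1 - p'.1| (rho (sval p.2) (sval p'.2)).

End Solenoid.

(* Main.v *)
Require Import Defs.
From mathcomp Require Import all_boot all_order all_algebra.
From mathcomp Require Import all_classical all_reals all_analysis.
From mathcomp.real_closed Require Import complex.
From mathcomp Require Import ring lra.
Set Implicit Arguments.
Unset Strict Implicit.
Unset Printing Implicit Defensive.
Import Order.TTheory GRing.Theory Num.Theory.
Import numFieldNormedType.Exports.
Local Open Scope ring_scope.

(** Two points of R / R_l Z represented by u and v are sent by phi to points
    of the unit circle at distance 2 |sin (pi (u - v) / R_l)|
    ([coord_dist_to_modZ]).  So, if n_l is the difference of integers that
    represent x_l and y_l, the metric d between A (a, x) and A (b, y) is the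
    maximum of 2 |sin (pi (a - b))| and of the numbers
    (2 / R_l) |sin (pi (a - b + n_(l+1)) / R_(l+1))| for l >= 0.

    Upper bound ([distY_A_le]).  If x_(l+1) = y_(l+1), then R_(l+1) divides
    n_(l+1), which disappears from |sin|, and |sin u| <= |u| bounds the term
    by 2 pi |a - b|.  Otherwise the term is at most 2 / R_l, and
    1 / R_l <= rho (x, y) because the first index at which x and y differ
    is at most l + 1.

    Lower bound.  Jordan's inequality gives |sin (pi t)| >= 2 dist (t, Z)
    ([norm_sin_pi_ge]).  The coordinate of index 0 controls |a - b|, since
    dist (a - b, Z) = |a - b| when |a - b| <= 1/2 ([norm_le_distY_A]).  For
    rho, let l + 1 be the first index at which x and y differ.  By coherence
    n_(l+1) is a multiple of R_l, but it is not a multiple of R_(l+1), so it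
    is at distance at least R_l from R_(l+1) Z.  Adding a - b lowers this
    distance by at most 1/2 <= R_l / 2, so the argument of the sine divided
    by pi stays at distance at least R_l / (2 R_(l+1)) = 1 / (2 r_(l+1)) from
    Z, which is bounded below as soon as r is bounded ([rho_le_distY_A]). *)

Section Sine.
Variable R : realType.
Implicit Types (t u : R) (k : int).

Let sin_MVT u v : u < v ->
  exists2 c, c \in `]u, v[%R & sin v - sin u = cos c * (v - u).
Proof.
move=> uv; apply: MVT => //; apply: continuous_subspaceT; exact: continuous_sin.
Qed.

Lemma norm_sinN u : `|sin (- u)| = `|sin u|.
Proof. by rewrite sinN normrN. Qed.

Lemma norm_sin_le u : `|sin u| <= `|u|.
Proof.
wlog u0 : u / 0 <= u.
  move=> H; have [/H //|/ltW u0] := leP 0 u.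
  by rewrite -norm_sinN -[X in _ <= X]normrN H ?oppr_ge0.
move: u0; rewrite le_eqVlt => /orP[/eqP <-|/sin_MVT[c _]].
  by rewrite sin0.
by rewrite sin0 !subr0 => ->; rewrite normrM ler_piMl // cos_max.
Qed.

(** The concavity of the sine on this interval: the slope of its chord over
    0 <= v <= u is at least the slope of its chord over u <= v <= pi / 2. *)
Lemma jordan_sin u : 0 <= u <= pi / 2 -> u <= pi / 2 * sin u.
Proof.
have p0 := pi_gt0 R.
move=> /andP[]; rewrite le_eqVlt => /orP[/eqP <- _|u0].
  by rewrite sin0 mulr0.
rewrite le_eqVlt => /orP[/eqP ->|up]; first by rewrite sin_pihalf mulr1.
have [c] := sin_MVT u0; have [d] := sin_MVT up.
rewrite !in_itv /= => /andP[ud dp] dE /andP[c0 cu] cE.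
move: dE cE; rewrite sin_pihalf sin0 !subr0 => dE cE.
have dc : cos d <= cos c by rewrite ltW // ltr_cos ?in_itv /=; lra.
have : u * (1 - sin u) <= (pi / 2 - u) * sin u.
  rewrite dE cE [leLHS]mulrCA [leRHS]mulrCA [u * (_ - _)]mulrC.
  by rewrite ler_wpM2r // mulr_ge0; lra.
by lra.
Qed.

Lemma norm_sin_shift_pi t k : `|sin (pi * (t + k%:~R))| = `|sin (pi * t)|.
Proof.
have N (n : nat) (s : R) : `|sin (pi * (s + n%:R))| = `|sin (pi * s)|.
  elim: n => [|n IH]; first by rewrite addr0.
  by rewrite -natr1 addrA mulrDr mulr1 sinDpi normrN.
case: k => n; first exact: N.
by rewrite NegzE rmorphN /= -[RHS](N n.+1) -[in RHS](subrK n.+1%:R t) N N.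
Qed.

(** Up to a translation by an integer |t| <= 1/2, where Jordan's inequality
    applies. *)
Lemma norm_sin_pi_ge t (e : R) :
  (forall k, e <= `|t - k%:~R|) -> 2 * e <= `|sin (pi * t)|.
Proof.
have p0 := pi_gt0 R.
pose k := Num.floor (t + 1 / 2); move=> /(_ k).
have := floor_le (t + 1 / 2); have := floorD1_gt (t + 1 / 2).
rewrite -/k rmorphD /= => k1 k2 tk; rewrite -(norm_sin_shift_pi _ (- k)) rmorphN /=.
apply: le_trans (_ : 2 * `|t - k%:~R| <= _); first by rewrite ler_pM2l.
have {tk} : - (1 / 2) <= t - k%:~R <= 1 / 2 by lra.
move: (t - _) => {k k1 k2} s.
wlog s0 : s / 0 <= s.
  move=> H s12; have [/H -> //|/ltW sn] := leP 0 s.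
  rewrite -normrN -norm_sinN -mulrN H //; lra.
move=> /andP[_ s12].
have := @jordan_sin (pi * s); rewrite mulr_ge0 ?(ltW p0) //= ler_pM2l //.
rewrite -mulrA ler_pM2l // => h; rewrite ger0_norm // (le_trans _ (ler_norm _)) //.
by move: h; lra.
Qed.

End Sine.

Section Solenoid.
Variables (R : realType) (r : nat -> nat).
Hypothesis r_ge2 : forall j, (1 <= j)%N -> (2 <= r j)%N.
Local Notation R_ := (Rprod r).

Lemma norm_intr_ge1 (k : int) : k != 0 -> 1 <= `|k%:~R : R|.
Proof. by move=> k0; rewrite -intr_norm ler1z -gtz0_ge1 normr_gt0. Qed.

(** With m and h the half sum and half difference of s and t, the difference
    of the exponentials is 2 i sin h times the unit vector of angle m. *)
Lemma normc_expiB (s t : R) :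
  Normc.normc (expi s - expi t) = 2 * `|sin ((s - t) / 2)|.
Proof.
pose m := (s + t) / 2; pose h := (s - t) / 2.
have -> : s = m + h by rewrite /m /h; field.
have -> : t = m - h by rewrite /m /h; field.
have -> : (m + h - (m - h)) / 2 = h by field.
rewrite /= cosD cosB sinD sinB.
have := cos2Dsin2 m; move: (cos m) (sin m) (cos h) (sin h) => c s' c' h' e.
rewrite (_ : _ ^+ 2 + _ = (2 * h') ^+ 2 * (c ^+ 2 + s' ^+ 2)); last by ring.
by rewrite e mulr1 sqrtr_sqr normrM ger0_norm.
Qed.

Lemma Rprod_gt0 l : (0 < R_ l)%N.
Proof.
elim: l => [|l IH]; first by rewrite Rprod0.
by rewrite RprodS muln_gt0 IH (leq_trans _ (r_ge2 _)).
Qed.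

Lemma coord_dist_to_modZ l (u v : R) :
  coord_dist (to_modZ (R_ l) u) (to_modZ (R_ l) v) =
  2 * `|sin (pi * ((u - v) / (R_ l)%:R))|.
Proof.
rewrite /coord_dist !phi_to_modZ normc_expiB; congr (2 * `|sin _|).
by field; rewrite pnatr_eq0 -lt0n Rprod_gt0.
Qed.

Lemma leq_Rprod m l : (m <= l)%N -> (R_ m <= R_ l)%N.
Proof.
move=> /subnKC <-; elim: (l - m)%N => [|k IH]; first by rewrite addn0.
by rewrite addnS RprodS (leq_trans IH) // leq_pmulr // (leq_trans _ (r_ge2 _)).
Qed.

(** This integer depends on chosen representatives of the residues of index
    l.+1; only its residue modulo [Rprod r l.+1] is meaningful. *)
Definition zdiff (x y : X0 r) (l : nat) : int := lift_modZ (x l) - lift_modZ (y l).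

Lemma A_coord0 (a : R) (x : Y0 r) : val (A (a, x)) 0%N = to_modZ (R_ 0) a.
Proof. by rewrite /A -[LHS]/(to_modZ (R_ 0) a + 0) addr0. Qed.

Lemma A_coordS (a : R) (x : Y0 r) l :
  val (A (a, x)) l.+1 = to_modZ (R_ l.+1) (a + (lift_modZ (sval x l))%:~R).
Proof. by rewrite to_modZD. Qed.

Lemma coord_dist_A0 (a b : R) (x y : Y0 r) :
  coord_dist (val (A (a, x)) 0%N) (val (A (b, y)) 0%N) =
  2 * `|sin (pi * (a - b))|.
Proof. by rewrite !A_coord0 coord_dist_to_modZ Rprod0 divr1. Qed.

Lemma coord_dist_AS (a b : R) (x y : Y0 r) l :
  coord_dist (val (A (a, x)) l.+1) (val (A (b, y)) l.+1) =
  2 * `|sin (pi * ((a - b + (zdiff (sval x) (sval y) l)%:~R) / (R_ l.+1)%:R))|.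
Proof.
rewrite !A_coordS coord_dist_to_modZ /zdiff rmorphB /=.
by rewrite opprD addrACA.
Qed.

Lemma eq_zdiffP (x y : X0 r) l :
  x l = y l <-> exists k : int, zdiff x y l = k * (R_ l.+1)%:Z.
Proof.
rewrite -[x l]lift_modZK -[y l]lift_modZK to_modZ_eqP.
by split=> -[k kE]; exists k; move: kE; rewrite intz natz.
Qed.

(** By coherence, agreement at index l.-1, where the modulus is [Rprod r l],
    says that the residues at index l agree modulo [Rprod r l]; for l = 0 this
    modulus is 1. *)
Lemma Rprod_zdiff (x y : X0 r) l : coherent0 x -> coherent0 y ->
  (forall i, (i < l)%N -> x i = y i) ->
  exists k : int, zdiff x y l = k * (R_ l)%:Z.
Proof.
case: l => [|l] xc yc xy; first by exists (zdiff x y 0); rewrite Rprod0 mulr1.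
have := xy l (ltnSn l); rewrite xc yc => /to_modZ_eqP[k kE].
by exists k; rewrite /zdiff kE intz natz.
Qed.

Lemma rho_first_diff (x y : X0 r) : x <> y ->
  exists l, [/\ rho R x y = (R_ l)%:R^-1, x l <> y l &
                forall i, (i < l)%N -> x i = y i].
Proof.
move=> xy; rewrite /rho; case: pselect => // xy'; rewrite /first_diff /=.
case: ex_minnP => l /eqP xyl lmin; exists l; split=> // i il.
by apply/eqP; apply: contraTT il => /lmin; rewrite -leqNgt.
Qed.

Lemma rho_ge0 (x y : X0 r) : 0 <= rho R x y.
Proof. by rewrite /rho; case: pselect => // xy; rewrite invr_ge0. Qed.

Lemma rho_ge (x y : X0 r) l : x l <> y l -> (R_ l)%:R^-1 <= rho R x y.
Proof.
move=> xyl; have /rho_first_diff[m [-> _ mmin]] : x <> y.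
  by move=> xy; apply: xyl; rewrite xy.
rewrite lef_pV2 ?posrE ?ltr0n ?Rprod_gt0 // ler_nat leq_Rprod // leqNgt.
by apply/negP => /mmin.
Qed.

Lemma distY_A_le (a b : R) (x y : Y0 r) :
  distY (A (a, x)) (A (b, y)) <= 2 * pi * D (a, x) (b, y).
Proof.
have p0 := pi_gt0 R; have p2 := pi_ge2 R.
have Dab : `|a - b| <= D (a, x) (b, y) by rewrite /D le_max lexx.
have Drho : rho R (sval x) (sval y) <= D (a, x) (b, y).
  by rewrite /D le_max lexx orbT.
rewrite {1}/distY; have [_ [l <-]] := distX_max r_ge2 (val (A (a, x))) (val (A (b, y))).
(* What a coordinate contributes when the profinite parts x and y agree there;
   c is the inverse of the modulus. *)
have real_part (c : R) : 0 < c <= 1 ->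
    2 * `|sin (pi * ((a - b) * c))| <= 2 * pi * D (a, x) (b, y).
  move=> /andP[c0 c1]; rewrite -mulrA ler_pM2l //.
  rewrite (le_trans (norm_sin_le _)) // normrM gtr0_norm // ler_pM2l //.
  by rewrite (le_trans _ Dab) // normrM (gtr0_norm c0) ler_piMr.
have w1 i : 0 < ((R_ i)%:R^-1 : R) <= 1.
  by rewrite invr_gt0 ltr0n Rprod_gt0 invf_le1 ?ltr0n ?ler1n Rprod_gt0.
case: l => [|l].
  rewrite coord_dist_A0 /= mul1r.
  by have := real_part 1; rewrite mulr1 ltr01 lexx; apply.
rewrite coord_dist_AS /weight; have /andP[w_gt0 w_le1] := w1 l.
have [/eq_zdiffP[k ->]|xyl] := eqVneq (sval x l) (sval y l).
  rewrite rmorphM /= -pmulrn [(_ + _) / _]mulrDl mulfK ?pnatr_eq0 -?lt0n ?Rprod_gt0 //.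
  by rewrite norm_sin_shift_pi (le_trans _ (real_part _ (w1 l.+1))) // ler_piMl.
apply: le_trans (_ : 2 * D (a, x) (b, y) <= _); last first.
  rewrite ler_wpM2r ?(le_trans _ Dab) //; lra.
rewrite mulrCA ler_pM2l // (le_trans _ Drho) //.
by rewrite (le_trans _ (rho_ge (elimN eqP xyl))) // ler_piMr ?sin_max // ltW.
Qed.

(** A nonzero integer is at distance at least 1/2 from a - b, hence no integer
    is closer to a - b than 0. *)
Lemma norm_le_distY_A (a b : R) (x y : Y0 r) : `|a - b| <= 1 / 2 ->
  4 * `|a - b| <= distY (A (a, x)) (A (b, y)).
Proof.
move=> ab; have [/(_ 0%N) + _] := distX_max r_ge2 (val (A (a, x))) (val (A (b, y))).
apply: le_trans; rewrite coord_dist_A0 /= mul1r.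
have : 2 * `|a - b| <= `|sin (pi * (a - b))|; last by lra.
apply: norm_sin_pi_ge => k.
have [->|k0] := eqVneq k 0; first by rewrite subr0.
have k1 := norm_intr_ge1 k0.
have := ler_normD (k%:~R - (a - b)) (a - b); rewrite subrK distrC.
lra.
Qed.

(** If x and y first differ at the index l.+1, that coordinate alone
    contributes at least (1 / R_l) * (2 / B), and rho (x, y) = 1 / R_l. *)
Lemma rho_le_distY_A (B : nat) (a b : R) (x y : Y0 r) :
  (forall j, (1 <= j)%N -> (r j <= B)%N) -> `|a - b| <= 1 / 2 ->
  2 * rho R (sval x) (sval y) <= B%:R * distY (A (a, x)) (A (b, y)).
Proof.
move=> rB ab; have [xy|] := pselect (sval x = sval y).
  rewrite /rho; case: pselect => // _; rewrite mulr0 mulr_ge0 //.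
  by rewrite (le_trans _ (norm_le_distY_A x y ab)) ?mulr_ge0.
case/rho_first_diff=> l [-> xyl lmin].
have [n nE] := Rprod_zdiff (svalP x) (svalP y) lmin.
have [/(_ l.+1) + _] := distX_max r_ge2 (val (A (a, x))) (val (A (b, y))).
rewrite coord_dist_AS nE /weight -/(distY _ _) => d_ge.
have rl0 : 0 < (r l.+1)%:R :> R by rewrite ltr0n (leq_trans _ (r_ge2 _)).
have rlB : (r l.+1)%:R <= B%:R :> R by rewrite ler_nat rB.
have B0 : 0 < B%:R :> R by lra.
have Rl1 : 1 <= (R_ l)%:R :> R by rewrite ler1n Rprod_gt0.
have Rl0 : 0 < (R_ l)%:R :> R by lra.
(* It remains to bound from below the sine of the coordinate at which x and y
   first differ. *)
set S := `|sin _| in d_ge; suff sin_ge : B%:R^-1 <= S.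
  have := ler_wpM2l (ltW B0) d_ge; apply: le_trans.
  move: sin_ge; rewrite -div1r ler_pdivrMr // => sin_ge.
  rewrite [leRHS](_ : _ = 2 / (R_ l)%:R * (S * B%:R)); last by ring.
  by rewrite ler_peMr // divr_ge0 // ltW.
rewrite [leLHS](_ : _ = 2 * (2 * B%:R)^-1); last by field; rewrite gt_eqF.
(* The argument is at distance at least 1 / (2 B) from every integer k. *)
apply: norm_sin_pi_ge => k; set u := _ - _.
have -> : u = (a - b + (n - k * r l.+1)%:~R * (R_ l)%:R) / ((R_ l)%:R * (r l.+1)%:R).
  rewrite /u RprodS natrM rmorphB !rmorphM /= -!pmulrn.
  by field; rewrite !gt_eqF.
(* Otherwise n * R_ l would be a multiple of R_ l.+1. *)
have n0 : n - k * r l.+1 != 0.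
  apply/eqP => /subr0_eq nk; apply: xyl; apply/eq_zdiffP; exists k.
  by rewrite nE nk RprodS mulnC PoszM mulrA.
move: (n - _) n0 => m m0.
have m1 := norm_intr_ge1 m0.
have num_ge : (R_ l)%:R / 2 <= `|a - b + m%:~R * (R_ l)%:R|.
  have := ler_normB (a - b + m%:~R * (R_ l)%:R) (a - b).
  rewrite addrC addKr normrM (gtr0_norm Rl0) => h.
  have := ler_peMl (ltW Rl0) m1; lra.
rewrite normrM normfV (gtr0_norm (mulr_gt0 Rl0 rl0)) ler_pdivlMr ?mulr_gt0 //.
rewrite (le_trans _ num_ge) // mulrCA ler_pM2l // invfM -mulrA ler_piMr //.
by rewrite mulrC ler_pdivrMr // mul1r.
Qed.

End Solenoid.

Theorem mainTheorem2 (R : realType) (r : nat -> nat)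
    (r_ge2 : forall j, (1 <= j)%N -> (2 <= r j)%N) :
  (forall (a b : R) (x y : Y0 r),
     distY (A (a, x)) (A (b, y)) <= 2 * pi * D (a, x) (b, y)) /\
  ((exists B : nat, forall j, (1 <= j)%N -> (r j <= B)%N) ->
   exists c2 : R, 0 < c2 /\
     forall (a b : R) (x y : Y0 r), `|a - b| <= 1 / 2 ->
       D (a, x) (b, y) <= c2 * distY (A (a, x)) (A (b, y))).
Proof.
split=> [a b x y|[B rB]]; first exact: distY_A_le.
have B2 : 2 <= B%:R :> R by rewrite ler_nat (leq_trans (r_ge2 1%N isT)) ?rB.
(* B%:R / 2 suffices for rho; for |a - b| the constant 1/4 suffices, and
   B >= 2. *)
exists B%:R; split=> [|a b x y ab]; first by lra.
have ab_le := norm_le_distY_A r_ge2 x y ab.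
have rho_le := rho_le_distY_A r_ge2 x y rB ab.
have rho0 := rho_ge0 R (sval x) (sval y); have ab0 := normr_ge0 (a - b).
rewrite /D ge_max /=; apply/andP; split; last by lra.
by nra.
Qed.
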